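(* There exists a function $f:\mathbb{N}\times\mathbb{N}\to\mathbb{N}$ such that the following holds. Let $\mathbb{F}$ be a finite field, let $d\in\mathbb{N}$, and let $A$ be a matrix over $\mathbb{F}$ whose column matroid $M=M(A)$ satisfies $\mathrm{csd}(M)=d$ and $\mathrm{csd}(M\setminus e)<d$ for every element $e$ of $M$. Then $|M|\le f(|\mathbb{F}|,d)$.
   Context: Let $\mathbb{F}$ be a field and $A$ a matrix over $\mathbb{F}$ with $m$ rows; its columns (viewed as vectors of $\mathbb{F}^m$) form the ground set of the matroid, and $|M|$ is the number of elements (columns). For a linear subspace $K\subseteq\mathbb{F}^m$, $M(A,K)$ is the matroid on the columns of $A$ in which a set $\{u_1,\dots,u_\ell\}$ of columns is dependent iff there are $\alpha_1,\dots,\alpha_\ell\in\mathbb{F}$, not all $0$, with $\sum_i\alpha_iu_i\in K$; $M(A)=M(A,\{0\})$ is the usual column matroid. A matroid is connected if any two elements lie in a common circuit; its components are its maximal connected restrictions. The contraction$^*$-depth is defined recursively: if $M(A,K)$ has rank $0$ then $\mathrm{csd}(A,K)=0$; otherwise, if $M(A,K)$ is not connected, $\mathrm{csd}(A,K)$ is the maximum of $\mathrm{csd}(A_C,K)$ over the components $C$, where $A_C$ is the submatrix of $A$ formed by the columns of $C$; otherwise $\mathrm{csd}(A,K)=1+\min_{v\in\mathbb{F}^m}\mathrm{csd}(A,K+\mathrm{span}(v))$. For $M=M(A)$ we write $\mathrm{csd}(M)=\mathrm{csd}(A,\{0\})$, and $M\setminus e$ is represented by $A$ with column $e$ removed. 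*)

(* Defs.v *)
From HB Require Import structures.
From mathcomp Require Import all_boot all_order all_algebra all_field.
Set Implicit Arguments. Unset Strict Implicit. Unset Printing Implicit Defensive.
Import GRing.Theory.
Local Open Scope ring_scope.

(* Matroid M(A,K) on the columns of A : 'M[F]_(m,n) (columns indexed by 'I_n).
   A subspace K of F^m is represented (mxalgebra style) by the row space of a
   square matrix K : 'M[F]_m; the column j of A is viewed as the row vector
   (col j A)^T.  Restrictions M(A_C,K) are handled by carrying the ground set
   S : {set 'I_n} explicitly. *)

Section Matroid.
Variables (F : finFieldType) (m n : nat).
Implicit Types (A : 'M[F]_(m, n)) (K : 'M[F]_m) (S T C D : {set 'I_n}).

Definition mdependent A K T : bool :=
  [exists alpha : {ffun 'I_n -> F},
     [&& [exists j in T, alpha j != 0],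
         [forall j in ~: T, alpha j == 0] &
         (((\sum_(j in T) alpha j *: (col j A)^T)%R : 'rV[F]_m) <= K)%MS]].

Definition mcircuit A K C : bool :=
  mdependent A K C &&
  [forall D : {set 'I_n}, (D \proper C) ==> ~~ mdependent A K D].

Definition mrank A K S : nat :=
  (\max_(T : {set 'I_n} | (T \subset S) && ~~ mdependent A K T) #|T|)%N.

Definition mconnected A K S : Prop :=
  forall x y, x \in S -> y \in S -> x != y ->
    exists C, [&& mcircuit A K C, C \subset S, x \in C & y \in C].

Definition mcomponent A K S C : Prop :=
  [/\ C \subset S, C != set0, mconnected A K C &
      forall C', C \subset C' -> C' \subset S -> mconnected A K C' -> C' = C].

(* csd_le A K S d  <->  csd(A_S, K) <= d, where csd is given by the recursive
   definition of the paper (read as its least fixed point). *)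
Inductive csd_le A : 'M[F]_m -> {set 'I_n} -> nat -> Prop :=
| csd_rank0 K S d : mrank A K S = 0%N -> csd_le A K S d
| csd_disconn K S d : (0 < mrank A K S)%N -> ~ mconnected A K S ->
    (forall C, mcomponent A K S C -> csd_le A K C d) -> csd_le A K S d
| csd_conn K S d (v : 'rV[F]_m) : (0 < mrank A K S)%N -> mconnected A K S ->
    csd_le A (K + v)%MS S d -> csd_le A K S d.+1.

Definition csd_eq A K S d : Prop :=
  csd_le A K S d /\ forall d', csd_le A K S d' -> (d <= d')%N.

End Matroid.

(* Main.v *)
Require Import Defs.
From HB Require Import structures.
From mathcomp Require Import all_boot all_order all_algebra all_field.
From Stdlib Require Import Classical.
Set Implicit Arguments. Unset Strict Implicit. Unset Printing Implicit Defensive.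
Import GRing.Theory.
Local Open Scope ring_scope.

(* It suffices to find, inside any S with csd > d and bounded circuits, a
   subset of bounded size that still has csd > d. By induction on d there is
   such a set S0 for d - 1, and for each of the finitely many vectors v of
   span S0 a set S_v witnessing that csd stays > d - 1 modulo K + v. A vector v
   outside K + span S0 does not change the matroid on S0, so the union of all
   these sets, made connected by adding circuits, has csd > d.
   Circuits stay bounded because csd <= d forces |C| <= 2^d, contracting an
   element does not lengthen circuits, and contracting any vector at most
   halves them: a circuit modulo K + v is at most 2^|S0| times longer than
   some circuit modulo K + span S0. *)

(** * Linear relations modulo [K], and how circuit lengths change under contraction *)

Section Circuits.
Variables (F : finFieldType) (m n : nat).
Implicit Types (A : 'M[F]_(m, n)) (K : 'M[F]_m) (S T C D : {set 'I_n}).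
Implicit Types (a b c : 'rV[F]_n).

Definition supp a : {set 'I_n} := [set j | a 0 j != 0].

Lemma supp0P a : reflect (exists j, j \in supp a) (a != 0).
Proof.
apply: (iffP idP) => [/rV0Pn [j aj]|[j]]; first by exists j; rewrite inE.
by rewrite inE => aj; apply/rV0Pn; exists j.
Qed.

Lemma mul_trE A a : a *m A^T = \sum_j a 0 j *: (col j A)^T.
Proof. by rewrite mulmx_sum_row; apply: eq_bigr => j _; rewrite tr_col. Qed.

(** Coefficient families on [T] are replaced by row vectors on all columns whose support lies in
    [T], so that relations can be combined by matrix algebra. *)
Lemma dependentP A K T :
  reflect (exists a, [/\ a != 0, supp a \subset T & (a *m A^T <= K)%MS])
          (mdependent A K T).
Proof.
have sumE a : supp a \subset T ->
    \sum_(j in T) a 0 j *: (col j A)^T = a *m A^T.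
  move=> aT; rewrite mul_trE big_mkcond /=; apply: eq_bigr => j _.
  case: ifP => // jT; case: (eqVneq (a 0 j) 0) => [->|aj]; first by rewrite scale0r.
  by rewrite (subsetP aT) ?inE in jT.
apply: (iffP existsP) => [[w /and3P [/existsP [j /andP [jT wj]] /forallP w0 wK]]|].
  pose a : 'rV[F]_n := \row_i w i.
  have aT : supp a \subset T.
    apply/subsetP => i; rewrite inE mxE; apply: contraR => iT.
    by have := w0 i; rewrite inE iT.
  exists a; split=> //; first by apply/supp0P; exists j; rewrite inE mxE.
  by rewrite -sumE //; under eq_bigr do rewrite mxE.
case=> a [/supp0P [j ja] aT aK].
exists [ffun i => a 0 i]; apply/and3P; split.
- apply/existsP; exists j; rewrite (subsetP aT) //= ffunE.
  by move: ja; rewrite inE.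
- apply/forallP => i; apply/implyP; rewrite inE ffunE => iT.
  by apply: contraR iT => ai; rewrite (subsetP aT) // inE.
- by under eq_bigr do rewrite ffunE; rewrite sumE.
Qed.

Lemma dependentS A K T T' : T \subset T' -> mdependent A K T -> mdependent A K T'.
Proof.
move=> sTT' /dependentP [a [a0 aT aK]]; apply/dependentP; exists a; split=> //.
exact: subset_trans sTT'.
Qed.

Lemma circuitP A K C :
  mcircuit A K C <->
  [/\ C != set0, exists a, [/\ supp a = C & (a *m A^T <= K)%MS] &
      forall a, a != 0 -> supp a \subset C -> (a *m A^T <= K)%MS -> supp a = C].
Proof.
split=> [/andP [/dependentP [a [a0 aC aK]] /forallP minC]|[C0 [a [aC aK]] minC]].
  have min b : b != 0 -> supp b \subset C -> (b *m A^T <= K)%MS -> supp b = C.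
    move=> b0 bC bK; apply/eqP; rewrite eqEproper bC.
    apply/negP => bpC; have /implyP/(_ bpC)/negP := minC (supp b); apply.
    by apply/dependentP; exists b.
  split=> //; last by exists a; split=> //; apply: min.
  have /supp0P [j ja] := a0.
  by apply/set0Pn; exists j; apply: (subsetP aC).
apply/andP; split.
  apply/dependentP; exists a; rewrite aC; split=> //.
  by apply/supp0P; rewrite aC; apply/set0Pn.
apply/forallP => D; apply/implyP => DC; apply/negP => /dependentP [b [b0 bD bK]].
have bC := minC b b0 (subset_trans bD (proper_sub DC)) bK.
by move: DC; rewrite -bC properE bD andbF.
Qed.

Lemma elim_supp a b i : i \in supp a -> i \in supp b ->
  let c := a - (a 0 i / b 0 i) *: b in
  [/\ c 0 i = 0, supp c \subset (supp a :|: supp b) :\ i &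
      forall x, x \notin supp b -> c 0 x = a 0 x].
Proof.
rewrite !inE => ai bi c.
have ci : c 0 i = 0 by rewrite !mxE divfK ?subrr.
split=> // [|x].
  apply/subsetP => x; rewrite !inE; case: (eqVneq x i) => [->|_]; first by rewrite ci eqxx.
  apply: contraNT; rewrite negb_or !negbK => /andP [/eqP a0 /eqP b0].
  by rewrite !mxE a0 b0 mulr0 subrr.
by rewrite inE negbK !mxE => /eqP ->; rewrite mulr0 subr0.
Qed.

Lemma rel_elim A K a b t : (a *m A^T <= K)%MS -> (b *m A^T <= K)%MS ->
  ((a - t *: b) *m A^T <= K)%MS.
Proof.
move=> aK bK; rewrite mulmxBl -scalemxAl addmx_sub // eqmx_opp.
exact: scalemx_sub.
Qed.

(** Strong induction on the support size: a relation [a] whose support is not minimal can be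
    replaced by one of smaller support that still contains [x]. *)
Lemma circuit_in_supp A K a x : (a *m A^T <= K)%MS -> x \in supp a ->
  exists C, [/\ mcircuit A K C, x \in C & C \subset supp a].
Proof.
have [k] := ubnP #|supp a|; elim: k a => // k IH a ltk aK xa.
have [/existsP [b /and4P [b0 ba bK neq]]|/existsPn min] := boolP [exists b : 'rV[F]_n,
    [&& b != 0, supp b \subset supp a, (b *m A^T <= K)%MS & supp b != supp a]]; last first.
  exists (supp a); split=> //; apply/circuitP; split=> //; [|by exists a|].
    by apply/set0Pn; exists x.
  move=> b b0 ba bK; have := min b.
  by rewrite b0 ba bK /= negbK => /eqP.
have pba : supp b \proper supp a.
  by rewrite properEneq ba andbT.
have [xb|xb] := boolP (x \in supp b).
  have [C [cC xC Cb]] := IH b (leq_trans (proper_card pba) ltk) bK xb.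
  by exists C; split=> //; apply: subset_trans ba.
(* As [b] vanishes at [x], cancelling a coordinate [i] of [a] against [b] shrinks the support and
   keeps the entry at [x]. *)
have /supp0P [i ib] := b0.
have ia := subsetP ba _ ib.
have [ci sc cx] := elim_supp ia ib; set c := a - _ in ci sc cx.
have xc : x \in supp c by rewrite inE cx // -[_ != _](in_set (fun j => a 0 j != 0)).
have sca : supp c \subset supp a :\ i by rewrite (setUidPl ba) in sc.
have ltc : (#|supp c| < k)%N.
  rewrite -ltnS; apply: leq_trans ltk; rewrite ltnS (cardsD1 i (supp a)) ia add1n ltnS.
  exact: subset_leq_card.
have [C [cC xC Cc]] := IH c ltc (rel_elim _ aK bK) xc.
by exists C; split=> //; apply: subset_trans (subset_trans Cc sca) (subsetDl _ _).
Qed.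

Lemma circuit_sub A K C D : mcircuit A K C -> mcircuit A K D -> D \subset C -> D = C.
Proof.
move=> /circuitP [_ _ minC] /circuitP [D0 [a [aD aK]] _] DC.
by rewrite -aD minC // ?aD //; apply/supp0P; rewrite aD; apply/set0Pn.
Qed.

(** Strong circuit elimination: cancel [y] between the two relations; the entry at [x] survives
    because the relation of [D] is zero there. *)
Lemma circuit_elim A K C D x y : mcircuit A K C -> mcircuit A K D ->
  y \in C -> y \in D -> x \in C -> x \notin D ->
  exists E, [/\ mcircuit A K E, x \in E & E \subset (C :|: D) :\ y].
Proof.
move=> /circuitP [_ [a [aC aK]] _] /circuitP [_ [b [bD bK]] _] yC yD xC xD.
rewrite -aC in yC xC *; rewrite -bD in yD xD *.
have [_ sc cx] := elim_supp yC yD; set c := a - _ in sc cx.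
have xc : x \in supp c by rewrite inE cx //; move: xC; rewrite inE.
have [E [cE xE Ec]] := circuit_in_supp (rel_elim _ aK bK) xc.
by exists E; split=> //; apply: subset_trans Ec sc.
Qed.

(* Induction on |C :|: D|: eliminating y from the relations of C and D gives a
   circuit C1 through x which, unless C1 :|: D is smaller, contains C :\: D;
   the circuit D1 through z obtained in the same way then meets C1 away from y. *)
Lemma circuit_trans A K C D x y z : mcircuit A K C -> mcircuit A K D ->
  x \in C -> y \in C -> y \in D -> z \in D ->
  exists E, [/\ mcircuit A K E, E \subset C :|: D, x \in E & z \in E].
Proof.
have [k] := ubnP #|C :|: D|; elim: k C D y => // k IH C D y ltk cC cD xC yC yD zD.
have [zC|zC] := boolP (z \in C); first by exists C; rewrite subsetUl.
have [xD|xD] := boolP (x \in D); first by exists D; rewrite subsetUr.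
have small (E : {set _}) : E \subset (C :|: D) :\ y -> (#|E| < k)%N.
  move=> s; apply: leq_ltn_trans (subset_leq_card s) _.
  rewrite -ltnS; apply: leq_trans ltk.
  by rewrite [X in (_ < X.+1)%N](cardsD1 y) inE yC.
have [C1 [cC1 xC1 C1s]] := circuit_elim cC cD yC yD xC xD.
have [D1 [cD1 zD1]] := circuit_elim cD cC yD yC zD zC; rewrite setUC => D1s.
have C1U := subset_trans C1s (subsetDl _ _).
have D1U := subset_trans D1s (subsetDl _ _).
have yC1 : y \notin C1 by apply/negP => /(subsetP C1s); rewrite !inE eqxx.
have yD1 : y \notin D1 by apply/negP => /(subsetP D1s); rewrite !inE eqxx.
have [w wC1 wC] : exists2 w, w \in C1 & w \notin C.
  by apply/subsetPn/negP => /(circuit_sub cC cC1) E; rewrite E yC in yC1.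
have wD : w \in D by have := subsetP C1U _ wC1; rewrite inE (negPf wC).
have [E1|neq] := boolP (C :\: D \subset C1).
  have [u uD1 uD] : exists2 u, u \in D1 & u \notin D.
    by apply/subsetPn/negP => /(circuit_sub cD cD1) E; rewrite E yD in yD1.
  have uC : u \in C by have := subsetP D1U _ uD1; rewrite inE (negPf uD) orbF.
  have uC1 : u \in C1 by apply: (subsetP E1); rewrite inE uD.
  have U1 : C1 :|: D1 \subset (C :|: D) :\ y by rewrite subUset C1s.
  have [E [cE EU xE zE]] := IH C1 D1 u (small _ U1) cC1 cD1 xC1 uC1 uD1 zD1.
  by exists E; split=> //; apply: subset_trans EU (subset_trans U1 (subsetDl _ _)).
have U1 : C1 :|: D \subset C :|: D by rewrite subUset C1U subsetUr.
have lt1 : (#|C1 :|: D| < k)%N.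
  rewrite -ltnS; apply: leq_trans ltk; rewrite ltnS; apply: proper_card.
  rewrite properE U1; move: neq; apply: contra => /subsetP s.
  apply/subsetP => t; rewrite inE => /andP [tD tC].
  by have := s t; rewrite !inE tC (negPf tD) !orbF => ->.
have [E [cE EU xE zE]] := IH C1 D w lt1 cC1 cD xC1 wC1 wD zD.
by exists E; split=> //; apply: subset_trans EU U1.
Qed.

Definition circuits_le A K S L := forall C, mcircuit A K C -> C \subset S -> (#|C| <= L)%N.

(* The relations on C modulo K + v form a plane containing the one of full
   support, and two circuits of that plane already cover C. *)
Lemma circuit_halve A K C (v : 'rV_m) : mcircuit A K C ->
  exists D, [/\ mcircuit A (K + v)%MS D, D \subset C & (#|C| <= 2 * #|D|)%N].
Proof.
move=> cC; have /circuitP [C0 [a [aC aK]] minC] := cC.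
have aKv : (a *m A^T <= K + v)%MS by apply: submx_trans aK (addsmxSl _ _).
have /set0Pn [x xC] := C0; have xa : x \in supp a by rewrite aC.
have [D1 [cD1 xD1 D1C]] := circuit_in_supp aKv xa; rewrite aC in D1C.
have [->|neq1] := eqVneq C D1; first by exists D1; split=> //; rewrite leq_pmull.
have /circuitP [_ [b [bD1 bKv]] _] := cD1.
have xb : x \in supp b by rewrite bD1.
have [y yC yD1] : exists2 y, y \in C & y \notin D1.
  by apply/subsetPn; move: neq1; apply: contra => CD1; rewrite eqEsubset CD1.
have [cx0 sc cy] := elim_supp xa xb; set c := a - _ in cx0 sc cy.
have yc : y \in supp c by rewrite inE cy ?bD1 //; move: yC; rewrite -aC inE.
have [D2 [cD2 yD2 D2c]] := circuit_in_supp (rel_elim _ aKv bKv) yc.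
have D2C : D2 \subset C.
  apply: subset_trans D2c (subset_trans sc _).
  by rewrite aC bD1 (setUidPl D1C) subsetDl.
have xD2 : x \notin D2 by apply/negP => /(subsetP D2c); rewrite inE cx0 eqxx.
have /circuitP [_ [e [eD2 eKv]] _] := cD2.
have [[/= u1 u2] bE] := sub_addsmxP bKv.
have [[/= w1 w2] eE] := sub_addsmxP eKv.
have xe : x \notin supp e by rewrite eD2.
have b0 : b != 0 by apply/supp0P; exists x.
(* Without a [v] component, [b] would be a relation modulo [K] on a proper subset of the circuit
   [C]. *)
have s0 : u2 0 0 != 0.
  apply/negP => /eqP s0; case/negP: neq1; rewrite -bD1; apply/eqP.
  rewrite minC // ?bD1 // bE [u2]mx11_scalar s0 -scalemx1 scale0r mul0mx addr0.
  exact: submxMl.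
(* The coefficient is chosen to cancel [v], so [h] is a relation modulo [K] inside [C]. It is
   nonzero at [x], hence its support is all of [C], which forces [D1] and [D2] to cover [C]. *)
pose h := e - (w2 0 0 / u2 0 0) *: b.
have t0 : w2 0 0 != 0.
  apply/negP => /eqP t0; move: xD2; rewrite -eD2 (minC e) ?xC //.
  - by apply/supp0P; exists y; rewrite eD2.
  - by rewrite eD2.
  by rewrite eE [w2]mx11_scalar t0 -scalemx1 scale0r mul0mx addr0 submxMl.
have hK : (h *m A^T <= K)%MS.
  rewrite mulmxBl -scalemxAl bE eE scalerDr opprD addrACA.
  rewrite [u2]mx11_scalar [w2]mx11_scalar !mxE !mul_scalar_mx scalerA divfK // !eqxx !mulr1n.
  by rewrite subrr addr0 scalemxAl -mulmxBl submxMl.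
have hx : x \in supp h.
  move: xe xb; rewrite !inE negbK !mxE => /eqP -> xb.
  by rewrite sub0r oppr_eq0 !mulf_neq0 // invr_eq0.
have hU : supp h \subset D1 :|: D2.
  rewrite -bD1 -eD2; apply/subsetP => j; rewrite !inE !mxE; apply: contraNT.
  by rewrite negb_or !negbK => /andP [/eqP -> /eqP ->]; rewrite mulr0 subrr.
have UC : D1 :|: D2 = C.
  apply/eqP; rewrite eqEsubset subUset D1C D2C /=.
  rewrite -(minC h) //; first by apply/supp0P; exists x.
  by apply: subset_trans hU _; rewrite subUset D1C.
have : (#|C| <= #|D1| + #|D2|)%N by rewrite -UC cardsU leq_subr.
case: (leqP #|D1| #|D2|) => [le|/ltnW le] leC; [exists D2|exists D1]; split=> //.
  by rewrite mul2n -addnn (leq_trans leC) // leq_add2r.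
by rewrite mul2n -addnn (leq_trans leC) // leq_add2l.
Qed.

Lemma eq_circuit A K K' C : (forall v : 'rV_m, (v <= K)%MS = (v <= K')%MS) ->
  mcircuit A K C = mcircuit A K' C.
Proof.
move=> eqK; have dE T : mdependent A K T = mdependent A K' T.
  by apply: eq_existsb => a; rewrite eqK.
by rewrite /mcircuit dE; congr (_ && _); apply: eq_forallb => D; rewrite dE.
Qed.

(** A circuit [D] after contracting [j] is either [[set j]] itself, now a loop, or is contained in a
    circuit modulo [K] within [j |: D]. *)
Lemma circuits_le_col A K S L j : (0 < L)%N -> j \in S ->
  circuits_le A K S L -> circuits_le A (K + (col j A)^T)%MS S L.
Proof.
move=> L0 jS cL D cD DS; have /circuitP [D0 [b [bD bK]] minD] := cD.
have tr_colE : delta_mx 0 j *m A^T = (col j A)^T by rewrite -rowE tr_col.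
have [jD|jD] := boolP (j \in D).
  suff <- : [set j] = D by rewrite cards1.
  have sj : supp (delta_mx 0 j) = [set j].
    by apply/setP => i; rewrite !inE mxE eqxx /=; case: (i == j); rewrite ?oner_eq0 ?eqxx.
  rewrite -sj; apply: minD; rewrite ?sj ?sub1set // ?tr_colE ?addsmxSr //.
  by apply/supp0P; exists j; rewrite sj set11.
have [[/= u1 u2] bE] := sub_addsmxP bK.
(* Moving the multiple of column [j] to the left-hand side lifts [b] to a relation modulo [K]. *)
pose a := b - u2 0 0 *: delta_mx 0 j.
have aK : (a *m A^T <= K)%MS.
  rewrite mulmxBl -scalemxAl tr_colE bE {1}[u2]mx11_scalar mul_scalar_mx addrK.
  exact: submxMl.
have aE i : i != j -> a 0 i = b 0 i.
  by move=> ij; rewrite !mxE eqxx (negPf ij) mulr0 subr0.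
have [x xD] : exists x, x \in D by apply/set0Pn.
have xj : x != j by apply: contraNneq jD => <-.
have xa : x \in supp a by rewrite inE aE //; move: xD; rewrite -bD inE.
have [C [cC xC Ca]] := circuit_in_supp aK xa.
have saD : supp a \subset j |: D.
  apply/subsetP => i; rewrite in_setU1; case: eqVneq => //= ij.
  by rewrite -bD !inE aE.
have CS : C \subset S.
  by apply: subset_trans Ca (subset_trans saD _); rewrite subUset sub1set jS.
apply: leq_trans (cL _ cC CS); apply: subset_leq_card.
have /circuitP [_ [c [cCs cK]] _] := cC.
(* Conversely, dropping the entry at [j] turns the relation of [C] into one modulo the contracted
   space; it lives in [D], so by minimality it fills [D], and [D] is a subset of [C]. *)
pose c' := c - c 0 j *: delta_mx 0 j.
have c'E i : i != j -> c' 0 i = c 0 i.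
  by move=> ij; rewrite !mxE eqxx (negPf ij) mulr0 subr0.
have c'j : c' 0 j = 0 by rewrite !mxE !eqxx mulr1 subrr.
have sc' : supp c' \subset C :\ j.
  apply/subsetP => i; rewrite in_setD1 inE; case: (eqVneq i j) => [->|ij].
    by rewrite c'j eqxx.
  by rewrite c'E // -cCs inE.
rewrite -(minD c').
- exact: subset_trans sc' (subsetDl _ _).
- by apply/supp0P; exists x; rewrite inE c'E //; move: xC; rewrite -cCs inE.
- apply: subset_trans sc' _; rewrite subDset.
  exact: subset_trans Ca saD.
rewrite mulmxBl -scalemxAl tr_colE addmx_sub //.
  exact: submx_trans cK (addsmxSl _ _).
by rewrite eqmx_opp scalemx_sub // addsmxSr.
Qed.

(** Once all columns of [l] are contracted, adding [v] changes nothing. Undoing these contractions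
    one at a time costs a factor 2 each by [circuit_halve]. *)
Lemma circuits_le_span A K S L (l : seq 'I_n) (g : 'I_n -> F) (v : 'rV_m) :
  (0 < L)%N -> {subset l <= S} ->
  (v - \sum_(j <- l) g j *: (col j A)^T <= K)%MS ->
  circuits_le A K S L -> circuits_le A (K + v)%MS S (2 ^ size l * L).
Proof.
move=> L0; elim: l K => [|j l IH] K lS vK cL.
  rewrite big_nil subr0 in vK; rewrite mul1n => C; rewrite -(@eq_circuit A K); first exact: cL.
  by move=> w; rewrite (eqmxP (_ : K + v == K)%MS) // addsmxSl addsmx_sub submx_refl vK.
pose cj := (col j A)^T.
have jS : j \in S by apply: lS; rewrite inE eqxx.
have vK' : (v - \sum_(i <- l) g i *: (col i A)^T <= K + cj)%MS.
  rewrite big_cons in vK.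
  rewrite -[X in (X <= _)%MS](subrK (g j *: cj)) addmx_sub //.
    by apply: submx_trans (addsmxSl _ _); rewrite -addrA -opprD [X in - X]addrC.
  by rewrite scalemx_sub // addsmxSr.
have lS' : {subset l <= S} by move=> i il; apply: lS; rewrite inE il orbT.
have {}IH := IH _ lS' vK' (circuits_le_col L0 jS cL).
move=> C cC CS; have [D [cD DC leD]] := circuit_halve cj cC.
rewrite expnS -mulnA; apply: leq_trans leD _; rewrite leq_mul2l /=; apply: IH.
  rewrite -(@eq_circuit A (K + v + cj)%MS) // => w.
  by rewrite -!addsmxA [(v + cj)%MS]addsmxC.
exact: subset_trans CS.
Qed.

End Circuits.

(** * Basic properties of contraction-star-depth *)

Section Depth.
Variables (F : finFieldType) (m n : nat) (A : 'M[F]_(m, n)).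
Implicit Types (K : 'M[F]_m) (S T C D : {set 'I_n}) (a b : 'rV[F]_n).

Lemma mrank_eq0P K S :
  reflect (forall x, x \in S -> mdependent A K [set x]) (mrank A K S == 0%N).
Proof.
apply: (iffP eqP) => [r0 x xS|dep].
  apply: contraT => ind; have : (#|[set x]| <= mrank A K S)%N.
    by apply: leq_bigmax_cond; rewrite sub1set xS.
  by rewrite r0 cards1.
apply/eqP; rewrite -leqn0; apply/bigmax_leqP => T /andP [TS].
rewrite leqn0 cards_eq0; apply: contraR => /set0Pn [x xT].
by apply: dependentS (dep x (subsetP TS x xT)); rewrite sub1set.
Qed.

Lemma mrank0S K S T : T \subset S -> mrank A K S = 0%N -> mrank A K T = 0%N.
Proof.
move=> sTS /eqP/mrank_eq0P dep; apply/eqP/mrank_eq0P => x xT.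
exact/dep/(subsetP sTS).
Qed.

Definition mconnectedb K S := [forall x in S, forall y in S, (x != y) ==>
  [exists C : {set 'I_n}, [&& mcircuit A K C, C \subset S, x \in C & y \in C]]].

Lemma mconnectedP K S : reflect (mconnected A K S) (mconnectedb K S).
Proof.
apply: (iffP forall_inP) => [c x y xS yS xy|c x xS].
  by move/forall_inP: (c x xS) => /(_ y yS)/implyP/(_ xy)/existsP.
by apply/forall_inP => y yS; apply/implyP => xy; apply/existsP; apply: c.
Qed.

Lemma connected_sub_component K S C : C \subset S -> C != set0 ->
  mconnected A K C -> exists2 D, mcomponent A K S D & C \subset D.
Proof.
move=> CS C0 /mconnectedP cC.
have [|D /maxsetP [/andP [DS /mconnectedP cD] maxD] CD] :=
  @maxset_exists _ (fun D => (D \subset S) && mconnectedb K D) C.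
  by rewrite CS.
exists D => //; split=> //; first by apply: contraNneq C0 => D0; rewrite -subset0 -D0.
by move=> E DE ES /mconnectedP cE; apply: maxD; rewrite ?ES.
Qed.

Lemma circuit_connected K C : mcircuit A K C -> mconnected A K C.
Proof. by move=> cC x y xC yC _; exists C; rewrite cC subxx xC yC. Qed.

Lemma csd_leW K S d d' : csd_le A K S d -> (d <= d')%N -> csd_le A K S d'.
Proof.
move=> H; elim: H d' => {K S d} [K S d r0|K S d r nc _ IH|K S d v r c _ IH] d' le.
- exact: csd_rank0.
- by apply: csd_disconn => // C cC; apply: IH.
- by case: d' le => // d' le; apply: (csd_conn (v := v)) => //; apply: IH.
Qed.

(** It suffices to treat connected subsets of positive rank. Such a subset lies in one component of
    a disconnected [S], and for a connected [S] the same vector [v] serves for it. *)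
Lemma csd_leS K S T d : csd_le A K S d -> T \subset S -> csd_le A K T d.
Proof.
suff step K' T' d' : (forall C, C \subset T' -> mconnected A K' C ->
    (0 < mrank A K' C)%N -> csd_le A K' C d') -> csd_le A K' T' d'.
  move=> H; elim: H T => {K S d} [K S d r0|K S d r nc _ IH|K S d v r c _ IH] T TS.
  - exact/csd_rank0/(mrank0S TS).
  - apply: step => C CT cC rC.
    have C0 : C != set0.
      apply: contraTneq rC => ->; rewrite -eqn0Ngt; apply/mrank_eq0P => x.
      by rewrite inE.
    have [D cD CD] := connected_sub_component (subset_trans CT TS) C0 cC.
    exact: IH cD _ CD.
  - apply: step => C CT cC rC; apply: (csd_conn (v := v)) => //.
    exact/IH/(subset_trans CT).
move=> stepC; have [/eqP r0|r0] := boolP (mrank A K' T' == 0%N); first exact: csd_rank0.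
have r : (0 < mrank A K' T')%N by rewrite lt0n.
have [/mconnectedP c|/mconnectedP nc] := boolP (mconnectedb K' T').
  exact: stepC.
apply: csd_disconn => // C [CT C0 cC _].
have [/eqP rC|rC] := boolP (mrank A K' C == 0%N); first exact: csd_rank0.
by apply: stepC => //; rewrite lt0n.
Qed.

Lemma csd_le_connected K S d : mconnected A K S -> (0 < mrank A K S)%N ->
  csd_le A K S d -> exists d' (v : 'rV_m), d = d'.+1 /\ csd_le A (K + v)%MS S d'.
Proof.
move=> c r H; case: H c r => {K S d} [K S d -> //|K S d _ nc _ c //|K S d v _ _ H _ _].
by exists d, v.
Qed.

(** In rank 0 circuits are loops, a circuit never leaves its component, and each contracted vector
    at most halves a circuit. *)
Lemma csd_le_circuits K S d : csd_le A K S d -> circuits_le A K S (2 ^ d).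
Proof.
elim=> {K S d} [K S d r0|K S d r nc _ IH|K S d v r c _ IH] C cC CS.
- have /circuitP [/set0Pn [x xC] _ minC] := cC.
  have /eqP/mrank_eq0P/(_ x (subsetP CS x xC))/dependentP [a [a0 ax aK]] := r0.
  rewrite -(minC a) //; last by apply: subset_trans ax _; rewrite sub1set.
  by apply: leq_trans (subset_leq_card ax) _; rewrite cards1 expn_gt0.
- have C0 : C != set0 by have /circuitP [] := cC.
  have [D cD CD] := connected_sub_component CS C0 (circuit_connected cC).
  exact: IH cD C cC CD.
- have [D [cD DC le]] := circuit_halve v cC; apply: leq_trans le _.
  by rewrite expnS leq_mul2l IH // (subset_trans DC).
Qed.

Lemma sub_adds_rVP K (u w : 'rV_m) :
  reflect (exists t, (w - t *: u <= K)%MS) (w <= K + u)%MS.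
Proof.
apply: (iffP idP) => [/sub_addsmxP [[x y] /= ->]|[t wK]].
  exists (y 0 0); rewrite {1}[y]mx11_scalar mul_scalar_mx addrK.
  exact: submxMl.
rewrite -[w](subrK (t *: u)) addmx_sub ?scalemx_sub ?addsmxSr //.
exact: submx_trans wK (addsmxSl _ _).
Qed.

Lemma adds_rV_exchange K (u v : 'rV_m) : (u <= K + v)%MS -> ~~ (u <= K)%MS ->
  (K + v :=: K + u)%MS.
Proof.
move=> uKv uK; apply/eqmxP; rewrite !addsmx_sub !addsmxSl uKv !andbT /=.
have [t tK] := sub_adds_rVP _ _ _ uKv.
have t0 : t != 0 by apply: contraNneq uK => t0; rewrite t0 scale0r subr0 in tK.
apply/sub_adds_rVP; exists t^-1.
by rewrite -eqmx_opp opprB -[v](scalerK t0) -scalerBr scalemx_sub.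
Qed.

(** Equivalently, [K] and [K'] have the same intersection with the span of the columns in [S]. *)
Definition agree S K K' := forall a, supp a \subset S ->
  (a *m A^T <= K)%MS = (a *m A^T <= K')%MS.

Lemma agreeS S T K K' : T \subset S -> agree S K K' -> agree T K K'.
Proof. by move=> TS ag a aT; apply: ag; apply: subset_trans TS. Qed.

Lemma agree_dependent S K K' T : agree S K K' -> T \subset S ->
  mdependent A K T = mdependent A K' T.
Proof.
move=> ag TS; apply/dependentP/dependentP => -[a [a0 aT aK]]; exists a; split=> //.
  by rewrite -ag // (subset_trans aT).
by rewrite ag // (subset_trans aT).
Qed.

Lemma agree_mrank S K K' : agree S K K' -> mrank A K S = mrank A K' S.
Proof.
move=> ag; apply: eq_bigl => T; case TS: (T \subset S) => //=.
by rewrite (agree_dependent ag).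
Qed.

Lemma agree_connected S K K' : agree S K K' -> mconnected A K S -> mconnected A K' S.
Proof.
move=> ag c x y xS yS xy; have [C /and4P [cC CS xC yC]] := c x y xS yS xy.
exists C; rewrite CS xC yC !andbT; move: cC.
rewrite /mcircuit (agree_dependent ag) // => /andP [-> /forallP dep] /=.
apply/forallP => D; apply/implyP => DC; have := dep D; rewrite DC /=.
by rewrite (agree_dependent ag) // (subset_trans (proper_sub DC)).
Qed.

Lemma agree_sym S K K' : agree S K K' -> agree S K' K.
Proof. by move=> ag a aS; rewrite ag. Qed.

Lemma csd_le_agree S K K' d : csd_le A K S d -> agree S K K' -> csd_le A K' S d.
Proof.
move=> H; elim: H K' => {K S d} [K S d r0|K S d r nc _ IH|K S d v r c _ IH] K' ag.
- by apply: csd_rank0; rewrite -(agree_mrank ag).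
- apply: csd_disconn; first by rewrite -(agree_mrank ag).
    by move=> c; apply: nc; apply: agree_connected c; apply: agree_sym.
  move=> C [CS C0 cC maxC]; apply: (IH C); last exact: agreeS ag.
  split=> //; first by apply: agree_connected cC; apply/agree_sym/(agreeS CS).
  move=> D CD DS cD; apply: maxC => //.
  by apply: agree_connected cD; apply: agreeS ag.
have conn (v' : 'rV_m) : agree S (K + v)%MS (K' + v')%MS -> csd_le A K' S d.+1.
  move=> agv; apply: (csd_conn (v := v')); last exact: IH.
    by rewrite -(agree_mrank ag).
  exact: agree_connected c.
have [/existsP [a /and3P [aS aKv aK]]|/existsPn no] :=
    boolP [exists a : 'rV_n, [&& supp a \subset S, (a *m A^T <= K + v)%MS & ~~ (a *m A^T <= K)%MS]].
  (* Here [K + v] gains a vector of the span of [S]; by exchange that vector may replace [v]. *)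
  apply: (conn (a *m A^T)) => b bS; rewrite (adds_rV_exchange aKv aK).
  have abS t : supp (b - t *: a) \subset S.
    apply/subsetP => i; rewrite inE !mxE; apply: contraNT => iS.
    have out e : supp e \subset S -> e 0 i = 0.
      by move=> /subsetP/(_ i); rewrite inE (negPf iS); case: eqP => // _ /(_ isT).
    by rewrite !out // mulr0 subrr.
  by apply/sub_adds_rVP/sub_adds_rVP => -[t tK]; exists t;
    move: tK; rewrite scalemxAl -mulmxBl ag.
(* Otherwise [v] creates no new relation on [S], and the zero vector does the same for [K']. *)
apply: (conn 0) => b bS; rewrite addsmx0 -ag //.
by have := no b; rewrite bS /=; case: (boolP (b *m A^T <= K)%MS) => [bK _|_];
  [rewrite (submx_trans bK) ?addsmxSl | rewrite andbT => /negPf].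
Qed.

Lemma card_bigcup_le (I : finType) (P : {pred I}) (B : I -> {set 'I_n}) k :
  (forall i, P i -> #|B i| <= k)%N -> (#|\bigcup_(i in P) B i| <= #|P| * k)%N.
Proof.
move=> Bk; rewrite -sum_nat_const.
apply: (big_ind2 (fun (X : {set 'I_n}) x => #|X| <= x)%N) => //; first by rewrite cards0.
by move=> X x Y y leX leY; apply: leq_trans (leq_card_setU X Y) (leq_add leX leY).
Qed.

End Depth.

(** Here [s] bounds the set [S0], [q ^ s] the number of vectors spanned by it, and [2 ^ s * L] the
    circuits after contracting one of them; the factor [L.+1] pays for making the union
    connected. *)
Fixpoint witness_bound (q d L : nat) : nat :=
  if d is d'.+1 then
    let s := witness_bound q d' L in
    ((s + q ^ s * witness_bound q d' (2 ^ s * L)) * L.+1)%N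
  else 1%N.

(** * Small subsets that keep the depth large *)

Section Witness.
Variables (F : finFieldType) (m n : nat) (A : 'M[F]_(m, n)).
Implicit Types (K : 'M[F]_m) (S T C D : {set 'I_n}).

Lemma csd_gt_connected K S d : ~ csd_le A K S d ->
  exists C : {set 'I_n}, [/\ C \subset S, mconnected A K C & ~ csd_le A K C d].
Proof.
move=> nS; have [cS|ncS] := classic (mconnected A K S); first by exists S.
apply: NNPP => no; apply: nS.
have [/eqP r0|r0] := boolP (mrank A K S == 0%N); first exact: csd_rank0.
apply: csd_disconn; rewrite ?lt0n // => C [CS _ cC _].
by apply: NNPP => nC; apply: no; exists C.
Qed.

Lemma csd_gt_rank K S d : ~ csd_le A K S d -> (0 < mrank A K S)%N.
Proof. by move=> nS; rewrite lt0n; apply/eqP => r0; apply: nS; apply: csd_rank0. Qed.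

(** Joining every other element of [T] to the hub [x0] by a circuit is enough, since lying in a
    common circuit is transitive. *)
Lemma connected_hull K S T L x0 : mconnected A K S -> circuits_le A K S L ->
  T \subset S -> x0 \in T ->
  exists U : {set 'I_n}, [/\ T \subset U, U \subset S, mconnected A K U & (#|U| <= #|T| * L.+1)%N].
Proof.
move=> cS SL TS x0T; have x0S := subsetP TS _ x0T.
(* The choice is made for all indices at once, with [set0] as default at the hub and outside [S]. *)
have /fin_all_exists [B BP] (y : 'I_n) : exists C : {set 'I_n},
    if y \in S :\ x0 then [&& mcircuit A K C, C \subset S, x0 \in C & y \in C]
    else C == set0.
  case: (y \in S :\ x0) /idP => [|_]; last by exists set0.
  by rewrite in_setD1 => /andP [yx yS]; apply: cS => //; rewrite eq_sym.
pose U := T :|: \bigcup_(y in T) B y.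
have BU y : y \in T -> B y \subset U.
  by move=> yT; apply: subset_trans (subsetUr _ _); apply: bigcup_sup.
have hub z : z \in U -> z != x0 ->
    exists C : {set 'I_n}, [&& mcircuit A K C, C \subset U, x0 \in C & z \in C].
  have onT y : y \in T -> y != x0 -> [&& mcircuit A K (B y), B y \subset U, x0 \in B y & y \in B y].
    move=> yT yx; have := BP y; rewrite in_setD1 yx (subsetP TS) //=.
    by case/and4P => -> _ -> ->; rewrite BU.
  rewrite inE => /orP [zT zx|/bigcupP [y yT zB] zx]; first by exists (B z); apply: onT.
  have yx : y != x0.
    by apply: contraTneq zB => ->; have := BP x0; rewrite !inE eqxx /= => /eqP ->; rewrite inE.
  by exists (B y); have := onT y yT yx => /and4P [-> -> -> _]; rewrite zB.
exists U; split.
- exact: subsetUl.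
- rewrite subUset TS; apply/bigcupsP => y _; have := BP y.
  by case: ifP => [_ /and4P [] //|_ /eqP ->]; rewrite sub0set.
- move=> x y xU yU xy.
  have [x0E|xx] := eqVneq x x0; first by rewrite x0E in xy *; apply: hub; rewrite // eq_sym.
  have [y0E|yx] := eqVneq y x0.
    rewrite y0E; have [C /and4P [cC CU xC yC]] := hub x xU xx.
    by exists C; rewrite cC CU xC yC.
  have [C /and4P [cC CU xC yC]] := hub x xU xx.
  have [D /and4P [cD DU xD yD]] := hub y yU yx.
  have [E [cE EU xE yE]] := circuit_trans cC cD yC xC xD yD.
  by exists E; rewrite cE xE yE !andbT (subset_trans EU) // subUset CU.
rewrite mulnS; apply: leq_trans (leq_card_setU _ _) _; rewrite leq_add2l.
apply: card_bigcup_le => y _; have := BP y.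
by case: ifP => [_ /and4P [cB BS _ _]|_ /eqP ->]; [apply: SL | rewrite cards0].
Qed.

Lemma csd_gt_witness K S d L : (0 < L)%N -> circuits_le A K S L -> ~ csd_le A K S d ->
  exists T : {set 'I_n}, [/\ T \subset S, (#|T| <= witness_bound #|F| d L)%N & ~ csd_le A K T d].
Proof.
elim: d K S L => [|d IH] K S L L0 SL nS.
  have [x xS ind] : exists2 x, x \in S & ~~ mdependent A K [set x].
    apply: NNPP => no; apply: nS; apply: csd_rank0; apply/eqP/mrank_eq0P => x xS.
    by apply: contraT => ind; case: no; exists x.
  (* A single non-loop is connected of positive rank, so its depth is not 0. *)
  exists [set x]; rewrite sub1set cards1; split=> // H.
  have [y z /set1P -> /set1P ->||d' [v [//]]] := csd_le_connected _ _ H.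
    by rewrite eqxx.
  rewrite lt0n; apply/negP => /mrank_eq0P/(_ x (set11 x)).
  exact/negP.
have [C [CS cC nC]] := csd_gt_connected nS.
have rC := csd_gt_rank nC.
have CL : circuits_le A K C L by move=> D cD DC; apply: SL => //; apply: subset_trans CS.
have [|S0 [S0C leS0 nS0]] := IH K C L L0 CL.
  by move=> H; apply: nC; apply: csd_leW H _.
set s := witness_bound #|F| d L in leS0.
(* Vectors of the span of [S0] are indexed by coefficient functions; those in [W] below vanish off
   [S0], so there are at most [#|F| ^ s] of them. *)
pose lin (w : {ffun 'I_n -> F}) := \sum_(j <- enum S0) w j *: (col j A)^T.
have /fin_all_exists [B BP] (w : {ffun 'I_n -> F}) : exists T : {set 'I_n},
    [/\ T \subset C, (#|T| <= witness_bound #|F| d (2 ^ s * L))%N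
      & ~ csd_le A (K + lin w)%MS T d].
  apply: IH; first by rewrite muln_gt0 expn_gt0.
    move=> D cD DC; apply: (@leq_trans (2 ^ size (enum S0) * L)).
      apply: (circuits_le_span (g := w) (v := lin w) L0 _ _ CL) => //.
        by move=> j; rewrite mem_enum; apply: (subsetP S0C).
      by rewrite subrr sub0mx.
    by rewrite leq_mul2r leq_exp2l // -cardE leS0 orbT.
  (* [C] is connected of positive rank, so depth at most [d] modulo any added vector would give
     depth at most [d.+1] for [C]. *)
  by move=> H; apply: nC; apply: csd_conn H.
pose W := pffun_on (0 : F) (mem S0) predT.
pose T := S0 :|: \bigcup_(w in W) B w.
have [x0 x0S0] : exists x0, x0 \in S0.
  apply/set0Pn; apply: contra_notN nS0 => /eqP ->; apply: csd_rank0.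
  by apply/eqP/mrank_eq0P => x; rewrite inE.
have TC : T \subset C by rewrite subUset S0C; apply/bigcupsP => w _; have [] := BP w.
have cardT : (#|T| <= s + #|F| ^ s * witness_bound #|F| d (2 ^ s * L))%N.
  apply: leq_trans (leq_card_setU _ _) (leq_add leS0 _).
  apply: (@leq_trans (#|W| * witness_bound #|F| d (2 ^ s * L))).
    by apply: card_bigcup_le => w _; have [] := BP w.
  rewrite leq_mul2r card_pffun_on leq_exp2l ?finNzRing_gt1 //.
  by rewrite leS0 orbT.
have x0T : x0 \in T by rewrite inE x0S0.
have [U [TU UC cU cardU]] := connected_hull cC CL TC x0T.
exists U; split; first exact: subset_trans CS.
  by apply: leq_trans cardU _; rewrite leq_mul2r cardT orbT.
have S0U : S0 \subset U := subset_trans (subsetUl _ _) TU.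
have rU : (0 < mrank A K U)%N.
  rewrite lt0n; apply/eqP => r0; apply: nS0; apply: csd_rank0.
  exact: mrank0S r0.
move=> H; have [_ [v [[<-] {}H]]] := csd_le_connected cU rU H.
have linE (a : 'rV_n) : supp a \subset S0 -> exists2 w, w \in W & lin w = a *m A^T.
  move=> aS; exists [ffun j => a 0 j].
    apply/pffun_onP; split=> //; apply/subsetP => j; rewrite inE ffunE => aj.
    by apply: (subsetP aS); rewrite inE.
  rewrite mul_trE /lin big_enum [RHS](bigID (mem S0)) /= [X in _ + X]big1 ?addr0 => [|j jS].
    by apply: eq_bigr => j _; rewrite ffunE.
  case: (eqVneq (a 0 j) 0) => [->|aj]; first by rewrite scale0r.
  by rewrite (subsetP aS) ?inE in jS.
(* If [v] adds a vector of the span of [S0] outside [K], then [K + v] equals some [K + lin w],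
   contradicting the choice of [B w]. If not, [K] and [K + v] agree on [S0], contradicting the
   choice of [S0]. *)
have [/existsP [a /and3P [aS aKv aK]]|/existsPn no] := boolP [exists a : 'rV_n,
    [&& supp a \subset S0, (a *m A^T <= K + v)%MS & ~~ (a *m A^T <= K)%MS]].
  have [w wW wE] := linE a aS; have [_ _ nB] := BP w; apply: nB.
  have BU : B w \subset U.
    by apply: subset_trans TU; apply: subset_trans (subsetUr _ _); apply: bigcup_sup.
  apply: csd_le_agree (csd_leS H BU) _ => b _.
  by rewrite wE (adds_rV_exchange aKv aK).
apply: nS0; apply: csd_le_agree (csd_leS H S0U) _ => b bS.
by have := no b; rewrite bS /=; case: (boolP (b *m A^T <= K)%MS) => [bK _|_];
  [rewrite (submx_trans bK) ?addsmxSl | rewrite andbT => /negPf].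
Qed.

End Witness.

(** * The size bound for deletion-critical matroids *)

Theorem theorem1 :
  exists f : nat -> nat -> nat,
  forall (F : finFieldType) (m n d : nat) (A : 'M[F]_(m, n)),
    csd_eq A (0 : 'M[F]_m) [set: 'I_n] d ->
    (forall e : 'I_n, exists2 d' : nat, (d' < d)%N &
        csd_le A (0 : 'M[F]_m) ([set: 'I_n] :\ e) d') ->
    (n <= f #|F| d)%N.
Proof.
(* The witness is for depth above [d.-1], while depth [d] itself bounds circuits by [2 ^ d]. *)
exists (fun q d => witness_bound q d.-1 (2 ^ d)) => F m n d A [Ad minA] del.
have [/card0_eq n0|/card_gt0P [e0 _]] := posnP #|'I_n|.
  by case: n A {Ad minA del} n0 => // n A /(_ ord0).
case: d Ad minA del => [|d] Ad minA del; first by have [] := del e0.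
have nd : ~ csd_le A 0 [set: 'I_n] d by move=> /minA; rewrite ltnn.
have [|T [_ cardT nT]] := csd_gt_witness _ (csd_le_circuits Ad) nd.
  by rewrite expn_gt0.
(* A witness missing some [e] would lie in the deletion of [e], whose depth is too small. *)
apply: leq_trans cardT; suff -> : T = setT by rewrite cardsT card_ord.
apply/eqP; rewrite eqEsubset subsetT; apply/subsetP => e _; apply: contraT => eT.
have [d' lt H] := del e; case: nT; apply: csd_leS (csd_leW H lt) _.
by rewrite subsetD1 subsetT.
Qed.
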